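(* In the ring of formal power series in two commuting variables $x$ and $y$, define \begin{align*} F_1(x,y)&=\sum_{n\ge 0} (1-y;\,1-x)_n,\\ F_2(x,y)&=\sum_{n\ge 0}\frac{1}{(1-y)(1-x)^n}\left(\frac{1}{1-y};\,\frac{1}{1-x}\right)_{n}\left(\frac{1}{1-x};\,\frac{1}{1-x}\right)_{n},\\ F_3(x,y)&=\sum_{n\ge 0}\left(\frac{1-x}{1-y}\right)^{n+1}(1-x;\,1-x)_n,\\ G_1(x,y)&=\sum_{n\ge 0}(-1)^n\left(\frac{1}{1-y};\,\frac{1}{1-x}\right)_{n},\\ G_2(x,y)&=\sum_{n\ge 0}(1-y)(1-x)^n\,(1-y;\,1-x)_n\,(-(1-x);\,1-x)_n,\\ G_3(x,y)&=\sum_{n\ge 0}\left(\frac{1-x}{1-y}\right)^n(1-y;\,(1-x)^2)_n. \end{align*} Then, as identities of formal power series in $x$ and $y$, \[ F_1(x,y)=F_2(x,y)=F_3(x,y) \qquad\text{and}\qquad G_1(x,y)=G_2(x,y)=G_3(x,y). \]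
   Context: The $q$-Pochhammer symbol is $(a;q)_n=\prod_{k=0}^{n-1}(1-aq^k)$, with $(a;q)_0=1$. Expressions such as $\frac{1}{1-x}$ and $\frac{1}{1-y}$ denote the inverses of $1-x$ and $1-y$ in the ring of formal power series in $x$ and $y$ (e.g. over $\mathbb{C}$). Infinite sums are taken in the usual topology of formal power series: a sum converges if each monomial $x^iy^j$ has nonzero coefficient in only finitely many summands. All six sums converge in this sense. *)

(* Defs.v *)
From HB Require Import structures.
From mathcomp Require Import all_boot all_order all_algebra.
From mathcomp Require Import all_classical.

Set Implicit Arguments.
Unset Strict Implicit.
Unset Printing Implicit Defensive.

Import GRing.Theory.

Local Open Scope classical_set_scope.
Local Open Scope ring_scope.

(* Formal power series in two commuting variables x and y:                    *)
(* coef f i j is the coefficient of x^i y^j in f.                             *)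
Record fps2 (R : Type) := Fps2 { coef : nat -> nat -> R }.

Lemma fps2P (R : Type) (f g : fps2 R) :
  (forall i j, coef f i j = coef g i j) -> f = g.
Proof.
case: f g => [f] [g] /= fg; congr Fps2.
by apply/funext => i; apply/funext => j.
Qed.

HB.instance Definition _ (R : Type) := gen_eqMixin (fps2 R).
HB.instance Definition _ (R : Type) := gen_choiceMixin (fps2 R).

Section Fps2Ring.
Variable R : comNzRingType.
Implicit Types (f g h : fps2 R) (P Q : {poly {poly R}}).

Definition fps2_zero : fps2 R := Fps2 (fun _ _ => 0).
Definition fps2_one : fps2 R := Fps2 (fun i j => ((i == 0) && (j == 0))%N%:R).
Definition fps2_opp f : fps2 R := Fps2 (fun i j => - coef f i j).
Definition fps2_add f g : fps2 R := Fps2 (fun i j => coef f i j + coef g i j).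
Definition fps2_mul f g : fps2 R := Fps2 (fun i j =>
  \sum_(a < i.+1) \sum_(b < j.+1) coef f a b * coef g (i - a) (j - b)).

Fact fps2_addA : associative fps2_add.
Proof. by move=> f g h; apply: fps2P => i j /=; rewrite addrA. Qed.

Fact fps2_addC : commutative fps2_add.
Proof. by move=> f g; apply: fps2P => i j /=; rewrite addrC. Qed.

Fact fps2_add0 : left_id fps2_zero fps2_add.
Proof. by move=> f; apply: fps2P => i j /=; rewrite add0r. Qed.

Fact fps2_addN : left_inverse fps2_zero fps2_opp fps2_add.
Proof. by move=> f; apply: fps2P => i j /=; rewrite addNr. Qed.

HB.instance Definition _ :=
  GRing.isZmodule.Build (fps2 R) fps2_addA fps2_addC fps2_add0 fps2_addN.

(* The ring laws are inherited from bivariate polynomials by truncation.      *)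
Definition agree n P f :=
  forall i j, (i < n)%N -> (j < n)%N -> P`_i`_j = coef f i j.

Definition trunc n f : {poly {poly R}} :=
  \poly_(i < n) \poly_(j < n) coef f i j.

Lemma agree_trunc n f : agree n (trunc n f) f.
Proof. by move=> i j lti ltj; rewrite !coef_poly lti coef_poly ltj. Qed.

Lemma agree_one n : agree n 1 fps2_one.
Proof.
move=> i j _ _ /=; rewrite coef1.
by case: eqP => _; rewrite ?coef1 ?coef0.
Qed.

Lemma agree_mul n P Q f g :
  agree n P f -> agree n Q g -> agree n (P * Q) (fps2_mul f g).
Proof.
move=> Pf Qg i j lti ltj /=; rewrite coefM coef_sum; apply: eq_bigr => a _.
rewrite coefM; apply: eq_bigr => b _.
have lea : (a < n)%N by exact: leq_trans (ltn_ord a) lti.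
have leb : (b < n)%N by exact: leq_trans (ltn_ord b) ltj.
rewrite Pf // Qg //; first exact: leq_ltn_trans (leq_subr _ _) lti.
exact: leq_ltn_trans (leq_subr _ _) ltj.
Qed.

Lemma agree_eq f g : (forall n, exists2 P, agree n P f & agree n P g) -> f = g.
Proof.
move=> fg; apply: fps2P => i j.
have [P Pf Pg] := fg (maxn i j).+1.
by rewrite -Pf ?Pg // ltnS ?leq_maxl ?leq_maxr.
Qed.

Fact fps2_mulA : associative fps2_mul.
Proof.
move=> f g h; apply: agree_eq => n.
exists (trunc n f * (trunc n g * trunc n h)); last rewrite mulrA.
  by do ![apply: agree_mul | exact: agree_trunc].
by do ![apply: agree_mul | exact: agree_trunc].
Qed.

Fact fps2_mulC : commutative fps2_mul.
Proof.
move=> f g; apply: agree_eq => n.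
exists (trunc n f * trunc n g); last rewrite mulrC.
  by apply: agree_mul; exact: agree_trunc.
by apply: agree_mul; exact: agree_trunc.
Qed.

Fact fps2_mul1 : left_id fps2_one fps2_mul.
Proof.
move=> f; apply: agree_eq => n; exists (1 * trunc n f).
  by apply: agree_mul; [exact: agree_one | exact: agree_trunc].
by rewrite mul1r; exact: agree_trunc.
Qed.

Fact fps2_mulDl : left_distributive fps2_mul fps2_add.
Proof.
move=> f g h; apply: fps2P => i j /=; rewrite -big_split; apply: eq_bigr => a _.
by rewrite -big_split; apply: eq_bigr => b _; rewrite mulrDl.
Qed.

Fact fps2_one_neq0 : fps2_one != fps2_zero.
Proof.
apply/eqP => /(congr1 (fun f => coef f 0 0)) /= /eqP.
by rewrite oner_eq0.
Qed.

HB.instance Definition _ := GRing.Zmodule_isComNzRing.Build (fps2 R)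
  fps2_mulA fps2_mulC fps2_mul1 fps2_mulDl fps2_one_neq0.

(* f^-1 is the multiplicative inverse of f if there is one, and f otherwise.  *)
Definition fps2_unit : pred (fps2 R) := fun f => `[< exists g, g * f = 1 >].
Definition fps2_inv f : fps2 R :=
  if pselect (exists g, g * f = 1) is left e then projT1 (cid e) else f.

Fact fps2_mulV : {in fps2_unit, left_inverse 1 fps2_inv *%R}.
Proof.
move=> f /asboolP fu; rewrite /fps2_inv; case: pselect => // e.
by case: (cid e).
Qed.

Fact fps2_unitPl f g : g * f = 1 -> fps2_unit f.
Proof. by move=> gf; apply/asboolP; exists g. Qed.

Fact fps2_inv_out : {in [predC fps2_unit], fps2_inv =1 id}.
Proof.
by move=> f /asboolPn fu; rewrite /fps2_inv; case: pselect.
Qed.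

HB.instance Definition _ := GRing.ComNzRing_hasMulInverse.Build (fps2 R)
  fps2_mulV fps2_unitPl fps2_inv_out.

Definition fps2X : fps2 R := Fps2 (fun i j => ((i == 1) && (j == 0))%N%:R).
Definition fps2Y : fps2 R := Fps2 (fun i j => ((i == 0) && (j == 1))%N%:R).

Lemma coef_add f g i j : coef (f + g) i j = coef f i j + coef g i j.
Proof. by []. Qed.

Lemma coef_opp f i j : coef (- f) i j = - coef f i j.
Proof. by []. Qed.

Lemma coef_zero i j : coef (0 : fps2 R) i j = 0.
Proof. by []. Qed.

Lemma coef_one i j : coef (1 : fps2 R) i j = ((i == 0) && (j == 0))%N%:R.
Proof. by []. Qed.

Lemma coef_mul f g i j : coef (f * g) i j =
  \sum_(a < i.+1) \sum_(b < j.+1) coef f a b * coef g (i - a) (j - b).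
Proof. by []. Qed.

Lemma coef_bigsum (I : Type) (r : seq I) (p : pred I) (u : I -> fps2 R) i j :
  coef (\sum_(k <- r | p k) u k) i j = \sum_(k <- r | p k) coef (u k) i j.
Proof. exact: (big_morph (fun f => coef f i j)). Qed.

Lemma coef00_mul f g : coef (f * g) 0 0 = coef f 0 0 * coef g 0 0.
Proof. by rewrite coef_mul !big_ord1. Qed.

Lemma coef00_exp f n : coef (f ^+ n) 0 0 = coef f 0 0 ^+ n.
Proof. by elim: n => // n IHn; rewrite !exprS coef00_mul IHn. Qed.

Definition order_ge n f := forall i j, (i + j < n)%N -> coef f i j = 0.

Lemma order_ge0 f : order_ge 0 f.
Proof. by []. Qed.

Lemma order_ge1 f : coef f 0 0 = 0 -> order_ge 1 f.
Proof. by move=> f0 [|i] [|j] //; rewrite addSn. Qed.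

Lemma order_geM m n f g :
  order_ge m f -> order_ge n g -> order_ge (m + n) (f * g).
Proof.
move=> fm gn i j ltij; rewrite coef_mul big1 // => a _; rewrite big1 // => b _.
have [lt|ge] := ltnP (a + b) m; first by rewrite fm ?mul0r.
rewrite gn ?mulr0 //.
have lea : (a <= i)%N by rewrite -ltnS.
have leb : (b <= j)%N by rewrite -ltnS.
rewrite -(ltn_add2l (a + b)) addnACA !subnKC //.
by rewrite (leq_trans ltij) // leq_add2r.
Qed.

Lemma order_ge_prod n (u : nat -> fps2 R) :
  (forall k, coef (u k) 0 0 = 0) -> order_ge n (\prod_(k < n) u k).
Proof.
move=> u0; elim: n => [|n IHn]; first exact: order_ge0.
rewrite big_ord_recr /=; have := order_geM IHn (order_ge1 (u0 n)).
by rewrite addn1.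
Qed.

Lemma fps2_unit1 f : coef f 0 0 = 1 -> f \is a GRing.unit.
Proof.
move=> f1; pose z := 1 - f.
have z0 : coef z 0 0 = 0 by rewrite coef_add coef_opp f1 coef_one subrr.
have zn n : order_ge n (z ^+ n).
  rewrite -[n in z ^+ n]card_ord -prodr_const.
  exact: (@order_ge_prod _ (fun=> z)).
pose S n := \sum_(k < n) z ^+ k.
have coefS i j n : (i + j < n)%N -> coef (S n) i j = coef (S (i + j).+1) i j.
  elim: n => // n IHn; rewrite ltnS leq_eqVlt => /predU1P[-> //|ltn].
  by rewrite {1}/S big_ord_recr coef_add (zn n) // addr0 IHn.
pose g := Fps2 (fun i j => coef (S (i + j).+1) i j).
have gf : g * f = 1.
  apply: fps2P => i j; transitivity (coef (S (i + j).+1 * f) i j).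
    rewrite !coef_mul; apply: eq_bigr => a _; apply: eq_bigr => b _.
    by rewrite (coefS a b (i + j).+1) // ltnS leq_add // -ltnS.
  have -> : S (i + j).+1 * f = 1 - z ^+ (i + j).+1.
    by rewrite -opprB subrX1 -mulNr opprB [1 - z]subKr mulrC.
  by rewrite coef_add coef_opp zn ?subr0.
exact: (introT unitrPr (ex_intro _ g (etrans (mulrC f g) gf))).
Qed.

Lemma unit_1X : 1 - fps2X \is a GRing.unit.
Proof. by apply: fps2_unit1; rewrite coef_add coef_opp /= subr0. Qed.

Lemma unit_1Y : 1 - fps2Y \is a GRing.unit.
Proof. by apply: fps2_unit1; rewrite coef_add coef_opp /= subr0. Qed.

Lemma coef00_1X : coef (1 - fps2X) 0 0 = 1.
Proof. by rewrite coef_add coef_opp /= subr0. Qed.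

Lemma coef00_1Y : coef (1 - fps2Y) 0 0 = 1.
Proof. by rewrite coef_add coef_opp /= subr0. Qed.

Lemma coef00_inv f : coef f 0 0 = 1 -> coef f^-1 0 0 = 1.
Proof.
by move=> f1; rewrite -[LHS]mulr1 -{1}f1 -coef00_mul mulVr // fps2_unit1.
Qed.

(* Convergence in the usual topology of formal power series.                  *)
Definition summable (u : nat -> fps2 R) :=
  forall i j, finite_set [set n | coef (u n) i j != 0].

(* The infinite sum of a summable family; \sum_(n \in A) is the library's sum *)
(* of finitely supported families, so that a coefficient is 0 by default if   *)
(* infinitely many summands contribute to it.                                 *)
Definition fps2_sum (u : nat -> fps2 R) : fps2 R :=
  Fps2 (fun i j => \sum_(n \in [set: nat]) coef (u n) i j).

Lemma coef_fps2_sum (u : nat -> fps2 R) N i j :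
  (forall n, (N <= n)%N -> coef (u n) i j = 0) ->
  coef (fps2_sum u) i j = \sum_(n < N) coef (u n) i j.
Proof.
move=> u0 /=; rewrite -(fsbig_widen `I_N [set: nat]) //; first by rewrite -fsbig_ord.
by move=> n [_ /= /negP]; rewrite -leqNgt => /u0.
Qed.

Lemma order_ge_summable (u : nat -> fps2 R) :
  (forall n, order_ge n (u n)) -> summable u.
Proof.
move=> uP i j; apply: (@sub_finite_set _ _ `I_(i + j).+1); last exact: finite_II.
move=> n /= un; rewrite ltnS leqNgt; apply/negP => ltn.
by move: un; rewrite uP // eqxx.
Qed.

End Fps2Ring.

Definition qpoch (A : pzRingType) (a q : A) (n : nat) : A :=
  \prod_(k < n) (1 - a * q ^+ k).

Section Series.
Variable R : comNzRingType.
Local Notation x := (fps2X R).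
Local Notation y := (fps2Y R).

Definition F1_term (n : nat) : fps2 R := qpoch (1 - y) (1 - x) n.
Definition F2_term (n : nat) : fps2 R :=
  1 / ((1 - y) * (1 - x) ^+ n)
  * qpoch (1 / (1 - y)) (1 / (1 - x)) n
  * qpoch (1 / (1 - x)) (1 / (1 - x)) n.
Definition F3_term (n : nat) : fps2 R :=
  ((1 - x) / (1 - y)) ^+ n.+1 * qpoch (1 - x) (1 - x) n.
Definition G1_term (n : nat) : fps2 R :=
  (-1) ^+ n * qpoch (1 / (1 - y)) (1 / (1 - x)) n.
Definition G2_term (n : nat) : fps2 R :=
  (1 - y) * (1 - x) ^+ n * qpoch (1 - y) (1 - x) n
  * qpoch (- (1 - x)) (1 - x) n.
Definition G3_term (n : nat) : fps2 R :=
  ((1 - x) / (1 - y)) ^+ n * qpoch (1 - y) ((1 - x) ^+ 2) n.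

Definition F1 : fps2 R := fps2_sum F1_term.
Definition F2 : fps2 R := fps2_sum F2_term.
Definition F3 : fps2 R := fps2_sum F3_term.
Definition G1 : fps2 R := fps2_sum G1_term.
Definition G2 : fps2 R := fps2_sum G2_term.
Definition G3 : fps2 R := fps2_sum G3_term.

Lemma order_ge_qpoch (a q : fps2 R) n :
  coef a 0 0 = 1 -> coef q 0 0 = 1 -> order_ge n (qpoch a q n).
Proof.
move=> a1 q1; apply: (order_ge_prod (u := fun k => 1 - a * q ^+ k)) => k.
by rewrite coef_add coef_opp coef00_mul coef00_exp a1 q1 expr1n mulr1 subrr.
Qed.

Lemma order_ge_mull n (f g : fps2 R) : order_ge n g -> order_ge n (f * g).
Proof. by rewrite -{2}[n]add0n => gn; apply: order_geM. Qed.

Let cx : coef (1 - x) 0 0 = 1 := coef00_1X R.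
Let cy : coef (1 - y) 0 0 = 1 := coef00_1Y R.
Let cxV : coef (1 / (1 - x)) 0 0 = 1.
Proof. by rewrite mul1r; exact: coef00_inv. Qed.
Let cyV : coef (1 / (1 - y)) 0 0 = 1.
Proof. by rewrite mul1r; exact: coef00_inv. Qed.

Lemma F1_summable : summable F1_term.
Proof. by apply: order_ge_summable => n; exact: order_ge_qpoch. Qed.

Lemma F2_summable : summable F2_term.
Proof.
by apply: order_ge_summable => n; apply: order_ge_mull; exact: order_ge_qpoch.
Qed.

Lemma F3_summable : summable F3_term.
Proof.
by apply: order_ge_summable => n; apply: order_ge_mull; exact: order_ge_qpoch.
Qed.

Lemma G1_summable : summable G1_term.
Proof.
by apply: order_ge_summable => n; apply: order_ge_mull; exact: order_ge_qpoch.
Qed.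

Lemma G2_summable : summable G2_term.
Proof.
apply: order_ge_summable => n; rewrite /G2_term mulrAC.
by apply: order_ge_mull; exact: order_ge_qpoch.
Qed.

Lemma G3_summable : summable G3_term.
Proof.
apply: order_ge_summable => n; apply: order_ge_mull.
by apply: order_ge_qpoch; rewrite ?coef00_exp ?cx ?expr1n.
Qed.

End Series.

(* Main.v *)
Require Import Defs.
From mathcomp Require Import all_boot all_order all_algebra.
From mathcomp Require Import ring.
From mathcomp Require boolp.

(** Write a = 1 - y and q = 1 - x. A family f(a) of series obeying
    f(a) = b(a) + c(a) f(a s), where c(a) has no constant term, is determined
    by this equation: the difference of two solutions is c(a) c(a s) ...
    times another series, hence is divisible by products of every length. The
    series F_i all satisfy
      F(a) = 1 + (1 - a) F(a q),
    G_1 and G_2 satisfy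
      G(a) = 1 + ((1 - a) / a) G(a q),
    and G_3 satisfies the two-step iterate of the latter,
      G(a) = 1 / a + ((1 - a) (1 - a q) / (a^2 q)) G(a q^2).
    Each equation holds because the difference of the n-th terms of its two
    sides has the form T_n - T_(n+1). *)

Set Implicit Arguments.
Unset Strict Implicit.
Unset Printing Implicit Defensive.

Import GRing.Theory.
Local Open Scope ring_scope.

Section QPochhammer.
Variable A : comPzRingType.
Implicit Types a q : A.

Lemma qpoch0 a q : qpoch a q 0 = 1.
Proof. exact: big_ord0. Qed.

Lemma qpochSr a q n : qpoch a q n.+1 = qpoch a q n * (1 - a * q ^+ n).
Proof. exact: big_ord_recr. Qed.

Lemma qpochS a q n : qpoch a q n.+1 = (1 - a) * qpoch (a * q) q n.
Proof.
rewrite /qpoch big_ord_recl expr0 mulr1; congr (_ * _).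
by apply: eq_bigr => k _; rewrite exprS mulrA.
Qed.

End QPochhammer.

(** * Telescoping sums and uniqueness for functional equations *)

Section Order.
Variable R : comNzRingType.
Implicit Types f g : fps2 R.

Lemma order_geD n f g : order_ge n f -> order_ge n g -> order_ge n (f + g).
Proof. by move=> fn gn i j lt; rewrite coef_add fn ?gn ?addr0. Qed.

Lemma order_geN n f : order_ge n f -> order_ge n (- f).
Proof. by move=> fn i j lt; rewrite coef_opp fn ?oppr0. Qed.

Lemma order_ge_eq f g : (forall n, order_ge n (f - g)) -> f = g.
Proof.
move=> fg; apply: fps2P => i j; apply/eqP; rewrite -subr_eq0 -coef_opp -coef_add.
by rewrite (fg (i + j).+1).
Qed.

Lemma eq_fps2_sum (u v : nat -> fps2 R) :
  (forall n, u n = v n) -> fps2_sum u = fps2_sum v.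
Proof. by move=> /boolp.funext ->. Qed.

Lemma fps2_sum_partial (u : nat -> fps2 R) N :
  (forall n, order_ge n (u n)) ->
  order_ge N (fps2_sum u - \sum_(n < N) u n).
Proof.
move=> un i j lt; rewrite coef_add coef_opp coef_bigsum (@coef_fps2_sum _ _ N).
  by rewrite subrr.
by move=> n leNn; rewrite un // (leq_trans lt).
Qed.

(** Summing the last hypothesis over n < N leaves [t 0 - t N]. The two sides then differ by two
    tails of series and [t N], all of order at least N. *)
Lemma fps2_sum_telescope (u v t : nat -> fps2 R) (b c : fps2 R) :
  (forall n, order_ge n (u n)) -> (forall n, order_ge n (v n)) ->
  (forall n, order_ge n (t n)) -> t 0%N = b ->
  (forall n, u n - c * v n = t n - t n.+1) ->
  fps2_sum u = b + c * fps2_sum v.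
Proof.
move=> un vn tn <- uvt; apply: order_ge_eq => N.
have uvN : \sum_(n < N) u n = c * (\sum_(n < N) v n) + (t 0%N - t N).
  elim: N => [|N IHN]; first by rewrite !big_ord0 mulr0 subrr addr0.
  rewrite !big_ord_recr /= IHN -[u N](subrK (c * v N)) uvt; ring.
have -> : fps2_sum u - (t 0%N + c * fps2_sum v) =
    (fps2_sum u - \sum_(n < N) u n) - c * (fps2_sum v - \sum_(n < N) v n) - t N.
  by rewrite uvN; ring.
apply: order_geD; last exact: order_geN.
apply: order_geD; first exact: fps2_sum_partial.
by apply/order_geN/order_ge_mull/fps2_sum_partial.
Qed.

Lemma functional_equation_unique (s : fps2 R) (b c f g : fps2 R -> fps2 R) :
  coef s 0 0 = 1 ->
  (forall a, coef a 0 0 = 1 -> coef (c a) 0 0 = 0) ->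
  (forall a, coef a 0 0 = 1 -> f a = b a + c a * f (a * s)) ->
  (forall a, coef a 0 0 = 1 -> g a = b a + c a * g (a * s)) ->
  forall a, coef a 0 0 = 1 -> f a = g a.
Proof.
move=> s1 c0 fE gE a a1; apply: order_ge_eq => n.
(* [a] stays general because the induction hypothesis is used at [a * s]; each factor [c a] raises
   the order by one. *)
elim: n a a1 => [|n IHn] a a1; first exact: order_ge0.
have -> : f a - g a = c a * (f (a * s) - g (a * s)).
  by rewrite fE // gE //; ring.
rewrite -add1n; apply: order_geM; first exact/order_ge1/c0.
by apply: IHn; rewrite coef00_mul a1 s1 mulr1.
Qed.

End Order.

(** * The six series with 1 - y replaced by a variable [a] *)

Section FunctionalEquations.
Variables (R : comNzRingType) (q : fps2 R).
Hypothesis q1 : coef q 0 0 = 1.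
Implicit Types a : fps2 R.

Let qV : q * q^-1 = 1.
Proof. by rewrite divrr // fps2_unit1. Qed.

Let aV a : coef a 0 0 = 1 -> a * a^-1 = 1.
Proof. by move=> a1; rewrite divrr // fps2_unit1. Qed.

Let aqV a : coef a 0 0 = 1 -> (a * q)^-1 = a^-1 * q^-1.
Proof. by move=> a1; rewrite invrM ?fps2_unit1 // mulrC. Qed.

Let a2qV a : coef a 0 0 = 1 -> (a ^+ 2 * q)^-1 = a^-1 ^+ 2 * q^-1.
Proof. by move=> a1; rewrite aqV ?exprVn // coef00_exp a1 expr1n. Qed.

Let qV1 : coef q^-1 0 0 = 1.
Proof. exact: coef00_inv. Qed.

Let M1 a b : coef a 0 0 = 1 -> coef b 0 0 = 1 -> coef (a * b) 0 0 = 1.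
Proof. by rewrite coef00_mul => -> ->; rewrite mulr1. Qed.

Let B0 a : coef a 0 0 = 1 -> coef (1 - a) 0 0 = 0.
Proof. by rewrite coef_add coef_opp => ->; rewrite subrr. Qed.

Definition F1_at a := fps2_sum (fun n => qpoch a q n).
Definition F2_at a := fps2_sum (fun n =>
  a^-1 * q^-1 ^+ n * qpoch a^-1 q^-1 n * qpoch q^-1 q^-1 n).
Definition F3_at a := fps2_sum (fun n => (q / a) ^+ n.+1 * qpoch q q n).
Definition G1_at a := fps2_sum (fun n => (-1) ^+ n * qpoch a^-1 q^-1 n).
Definition G2_at a := fps2_sum (fun n =>
  a * q ^+ n * qpoch a q n * qpoch (- q) q n).
Definition G3_at a := fps2_sum (fun n => (q / a) ^+ n * qpoch a (q ^+ 2) n).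

(** Multiplying by 1 - a turns the series at [a * q] into the series at [a] without its first term,
    so [t] is the sequence of terms itself. *)
Lemma F1_at_eq a : coef a 0 0 = 1 -> F1_at a = 1 + (1 - a) * F1_at (a * q).
Proof.
move=> a1; apply: (fps2_sum_telescope (t := qpoch a q)) => [n|n|n||n].
- exact: order_ge_qpoch.
- by apply: order_ge_qpoch => //; exact: M1.
- exact: order_ge_qpoch.
- exact: qpoch0.
- by rewrite -qpochS.
Qed.

Lemma F2_at_eq a : coef a 0 0 = 1 -> F2_at a = 1 + (1 - a) * F2_at (a * q).
Proof.
move=> a1; have aV1 : coef a^-1 0 0 = 1 by exact: coef00_inv.
apply: (fps2_sum_telescope
  (t := fun n => qpoch a^-1 q^-1 n * qpoch q^-1 q^-1 n)) => [n|n|n||n].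
- exact/order_ge_mull/order_ge_qpoch.
- exact/order_ge_mull/order_ge_qpoch.
- exact/order_ge_mull/order_ge_qpoch.
- by rewrite !qpoch0 mulr1.
rewrite aqV //.
(* Since (1 - a) / a = -(1 - 1/a), the shifted symbol is completed to [qpoch a^-1 q^-1 n.+1]. *)
have -> : (1 - a) * (a^-1 / q * q^-1 ^+ n * qpoch (a^-1 / q) q^-1 n
    * qpoch q^-1 q^-1 n)
  = - (q^-1 ^+ n.+1 * ((1 - a^-1) * qpoch (a^-1 / q) q^-1 n)
    * qpoch q^-1 q^-1 n).
  by rewrite exprS; move: (aV a1) => aV'; ring: aV'.
by rewrite -qpochS !qpochSr exprS; ring.
Qed.

Lemma F3_at_eq a : coef a 0 0 = 1 -> F3_at a = 1 + (1 - a) * F3_at (a * q).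
Proof.
move=> a1; apply: (fps2_sum_telescope
  (t := fun n => a^-1 ^+ n * qpoch q q n)) => [n|n|n||n].
- exact/order_ge_mull/order_ge_qpoch.
- exact/order_ge_mull/order_ge_qpoch.
- exact/order_ge_mull/order_ge_qpoch.
- by rewrite qpoch0 mulr1.
(* The ratio q / a taken at [a * q] is 1 / a, whose powers are those in [t]. *)
rewrite aqV // [q * (_ / _)]mulrCA qV mulr1 qpochSr exprMn !exprS.
by move: (aV a1) => aV'; ring: aV'.
Qed.

(** As for [F1_at], the shift drops the first term: (1 - a) / a = -(1 - 1/a) supplies both the
    missing factor and the sign. *)
Lemma G1_at_eq a : coef a 0 0 = 1 ->
  G1_at a = 1 + (1 - a) / a * G1_at (a * q).
Proof.
move=> a1; have aV1 : coef a^-1 0 0 = 1 by exact: coef00_inv.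
apply: (fps2_sum_telescope
  (t := fun n => (-1) ^+ n * qpoch a^-1 q^-1 n)) => [n|n|n||n].
- exact/order_ge_mull/order_ge_qpoch.
- by apply/order_ge_mull/order_ge_qpoch; rewrite ?aqV //; exact: M1.
- exact/order_ge_mull/order_ge_qpoch.
- by rewrite qpoch0 mulr1.
rewrite aqV // qpochS exprS; move: (aV a1) => aV'; ring: aV'.
Qed.

Lemma G2_at_eq a : coef a 0 0 = 1 ->
  G2_at a = 1 + (1 - a) / a * G2_at (a * q).
Proof.
move=> a1; apply: (fps2_sum_telescope
  (t := fun n => qpoch a q n * qpoch (- q) q n)) => [n|n|n||n].
(* The factors of [qpoch (- q) q n] have constant term 2, so the order must come from the symbol in
   [a]. *)
- by rewrite mulrAC; exact/order_ge_mull/order_ge_qpoch.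
- by rewrite mulrAC; apply/order_ge_mull/order_ge_qpoch => //; exact: M1.
- by rewrite mulrC; exact/order_ge_mull/order_ge_qpoch.
- by rewrite !qpoch0 mulr1.
have -> : (1 - a) / a * (a * q * q ^+ n * qpoch (a * q) q n * qpoch (- q) q n)
  = q * q ^+ n * ((1 - a) * qpoch (a * q) q n) * qpoch (- q) q n.
  by move: (aV a1) => aV'; ring: aV'.
by rewrite -qpochS !qpochSr; ring.
Qed.

Lemma G3_at_eq a : coef a 0 0 = 1 ->
  G3_at a = a^-1 + (1 - a) * (1 - a * q) / (a ^+ 2 * q) * G3_at (a * q ^+ 2).
Proof.
move=> a1; have q2 : coef (q ^+ 2) 0 0 = 1 by rewrite expr2; exact: M1.
apply: (fps2_sum_telescope
  (t := fun n => a^-1 * (a * q)^-1 ^+ n * qpoch a (q ^+ 2) n)) => [n|n|n||n].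
- exact/order_ge_mull/order_ge_qpoch.
- by apply/order_ge_mull/order_ge_qpoch => //; exact: M1.
- exact/order_ge_mull/order_ge_qpoch.
- by rewrite qpoch0 !mulr1.
have -> : q / (a * q ^+ 2) = (a * q)^-1.
  by rewrite expr2 mulrA aqV ?M1 // mulrCA qV mulr1.
have -> : (1 - a) * (1 - a * q) / (a ^+ 2 * q)
      * ((a * q)^-1 ^+ n * qpoch (a * q ^+ 2) (q ^+ 2) n)
    = a^-1 * (1 - a * q) * (a * q)^-1 ^+ n.+1 * qpoch a (q ^+ 2) n.+1.
  by rewrite qpochS (a2qV a1) (aqV a1) [_ ^+ n.+1]exprS; ring.
(* This gives all terms the common factor (a q)^(-n); the rest is a polynomial identity modulo the
   relations defining the two inverses. *)
have -> : (q / a) ^+ n = (a * q)^-1 ^+ n * (q ^+ 2) ^+ n.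
  by rewrite -exprMn aqV //; congr (_ ^+ _); move: qV => qV'; ring: qV'.
rewrite qpochSr [_ ^+ n.+1]exprS (aqV a1).
move: (_ ^+ n) ((q ^+ 2) ^+ n) (qpoch _ _ _) => w z u.
move: a^-1 q^-1 (aV a1) qV => a' q' aK qK.
by ring: aK qK.
Qed.

(** * Equalities by uniqueness *)

Lemma F1_at_F2_at a : coef a 0 0 = 1 -> F1_at a = F2_at a.
Proof.
apply: (functional_equation_unique q1 _ F1_at_eq F2_at_eq); exact: B0.
Qed.

Lemma F2_at_F3_at a : coef a 0 0 = 1 -> F2_at a = F3_at a.
Proof.
apply: (functional_equation_unique q1 _ F2_at_eq F3_at_eq); exact: B0.
Qed.

Lemma G1_at_G2_at a : coef a 0 0 = 1 -> G1_at a = G2_at a.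
Proof.
apply: (functional_equation_unique q1 _ G1_at_eq G2_at_eq) => b b1.
by rewrite coef00_mul B0 // mul0r.
Qed.

(** Two steps of [G2_at_eq] give the inhomogeneous part 1 + (1 - a) / a = 1 / a. *)
Lemma G2_at_eq2 a : coef a 0 0 = 1 ->
  G2_at a = a^-1 + (1 - a) * (1 - a * q) / (a ^+ 2 * q) * G2_at (a * q ^+ 2).
Proof.
move=> a1; rewrite (G2_at_eq a1) (G2_at_eq (M1 a1 q1)).
have -> : a * q * q = a * q ^+ 2 by ring.
rewrite (aqV a1) (a2qV a1); move: (G2_at _) a^-1 (aV a1) => g a' aK.
by ring: aK.
Qed.

Lemma G2_at_G3_at a : coef a 0 0 = 1 -> G2_at a = G3_at a.
Proof.
apply: (functional_equation_unique _ _ G2_at_eq2 G3_at_eq) => [|b b1].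
  by rewrite expr2; exact: M1.
by rewrite !coef00_mul B0 // !mul0r.
Qed.

End FunctionalEquations.

Theorem theorem2p1 (R : comNzRingType) :
  (F1 R = F2 R /\ F2 R = F3 R) /\ (G1 R = G2 R /\ G2 R = G3 R).
Proof.
have [q1 a1] := (coef00_1X R, coef00_1Y R).
(* Only [F2] and [G1] need their inverses rewritten; the other four series match their families by
   conversion. *)
have F2E : F2 R = F2_at (1 - fps2X R) (1 - fps2Y R).
  apply: eq_fps2_sum => n.
  rewrite /F2_term !div1r invrM ?unitrX ?unit_1X ?unit_1Y //.
  by rewrite exprVn [_ / (1 - fps2Y R)]mulrC.
have G1E : G1 R = G1_at (1 - fps2X R) (1 - fps2Y R).
  by apply: eq_fps2_sum => n; rewrite /G1_term !div1r.
rewrite F2E G1E; split; split.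
- exact: F1_at_F2_at.
- exact: F2_at_F3_at.
- exact: G1_at_G2_at.
- exact: G2_at_G3_at.
Qed.
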